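(* Let $G$ be a finite abelian group whose Sylow-$2$-subgroup is cyclic, let $\mathcal{C}\subseteq G$ be inverse-closed, and let $X=X(G,\mathcal{C})$. If perfect state transfer occurs on $X$, then it occurs at time $\pi/2$.
   Context: The Cayley graph $X(G,\mathcal{C})$ of an abelian group $G$ (written additively) with inverse-closed connection set $\mathcal{C}\subseteq G$ has vertex set $G$, with $g$ and $h$ adjacent iff $h-g\in\mathcal{C}$ (it has a loop at every vertex iff $0\in\mathcal{C}$). For a graph $X$ with adjacency matrix $A$, the transition matrix at time $t\in\mathbb{R}$ is $U(t)=e^{itA}$. Perfect state transfer occurs on $X$ at time $\tau$ if there are distinct vertices $u,v$ with $|U(\tau)_{u,v}|=1$; perfect state transfer occurs on $X$ if this holds for some $\tau$. *)

(* Defs.v *)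
From HB Require Import structures.
From mathcomp Require Import all_boot all_order all_algebra all_fingroup all_solvable.
From mathcomp Require Import complex.
From mathcomp Require Import all_classical all_reals all_analysis.
Set Implicit Arguments.
Unset Strict Implicit.
Unset Printing Implicit Defensive.
Import Order.TTheory GRing.Theory Num.Theory.
Import numFieldNormedType.Exports.
Local Open Scope classical_set_scope.
Local Open Scope ring_scope.

(* [lim] is taken in the topology of entrywise convergence on matrices; it is
   an arbitrary point if the series diverges, which does not happen over [R[i]]
   with [R : realType]. *)
Definition expmx (K : numFieldType) (n : nat) (A : 'M[K]_n) : 'M[K]_n :=
  lim (series (fun k : nat => (k`!%:R)^-1 *: A ^+ k) @ \oo).

(* Graphs are given by their adjacency relation; matrices indexed by the
   vertices use the enumeration [enum_rank]/[enum_val] of the vertex type. *)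
Definition adjmx (K : pzRingType) (V : finType) (e : rel V) : 'M[K]_#|V| :=
  \matrix_(i, j) (e (enum_val i) (enum_val j))%:R.

Definition transition (R : realType) (V : finType) (e : rel V) (t : R)
    : 'M[R[i]]_#|V| :=
  expmx (('i * t%:C)%C *: adjmx R[i] e).

Definition pst_at (R : realType) (V : finType) (e : rel V) (tau : R) : Prop :=
  exists u v : V,
    u <> v /\ `|transition e tau (enum_rank u) (enum_rank v)| = 1.

Definition pst (R : realType) (V : finType) (e : rel V) : Prop :=
  exists tau : R, pst_at e tau.

Definition cayley (G : finZmodType) (C : {set G}) : rel G :=
  fun g h => h - g \in C.

(* Main.v *)
Require Import Defs.
From mathcomp Require Import all_boot all_order all_algebra all_fingroup all_solvable.
From mathcomp Require Import all_field complex.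
From mathcomp Require Import all_classical all_reals all_analysis.
From mathcomp Require Import ring zify.
Set Implicit Arguments.
Unset Strict Implicit.
Unset Printing Implicit Defensive.
Import Order.TTheory GRing.Theory Num.Theory.
Import numFieldNormedType.Exports.
Local Open Scope ring_scope.

(* A phase comparison over the additive characters chi of G, whose eigenvalues
   are lam chi = \sum_(c in C) chi c, shows that transfer from u to v at time tau
   means chi (v - u) = exp (i tau (|C| - lam chi)) for all chi.  As C = - C, the
   vertex a = v - u has order 2 and the exponents tau (|C| - lam chi) are integral
   multiples mu chi of pi, with chi a = (-1) ^ mu chi.  The |C| - lam chi are
   therefore proportional to the mu chi; their sum is an integer, so they are
   rational, hence integers t chi, and by Galois conjugation C is stable under
   multiplication by integers prime to |G|.

   Transfer at time pi/2 means that t chi / 2 is an integer with the parity of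
   mu chi for all chi.  By proportionality it is enough that t beta = 2 mod 4 for
   a single beta with beta a = -1, which we choose trivial on the odd part H of G.
   Since the 2-part is cyclic, a is its only involution.  Stability under units
   then makes C, outside a few cosets of H, invariant under translation by a and
   by an element q of order 4, and for every psi trivial on the 2-part
     lam (beta^2 psi) - lam (beta psi) = 2 \sum_(y in H) gap y * psi y,
   where gap y = [y + a \in C] - [y + q \in C] lies in {-1, 0, 1}.  If 4 divided
   t beta, it would divide every t chi; then |H| * gap y would be even for every
   y by Fourier inversion on H, gap would vanish because |H| is odd, and t beta
   would be equal to t (beta^2), contradicting the parity of mu. *)

(** * Characters of a finite abelian group *)

Definition additive_character (G : nmodType) (K : pzSemiRingType)
    (chi : G -> K) : Prop :=
  chi 0 = 1 /\ {morph chi : x y / x + y >-> x * y}.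

Lemma finZmod_mulrn (G : finZmodType) (g : G) : g *+ #|G| = 0.
Proof.
rewrite -FinRing.Theory.zmodXgE; apply/eqP.
by rewrite -order_dvdn -cardsT order_dvdG ?finset.in_setT.
Qed.

(** The regular representation of [G]. *)
Definition translation_mx (K : pzSemiRingType) (G : finZmodType) (g : G) :
    'M[K]_#|G| :=
  \matrix_(i, j) (enum_val i + g == enum_val j)%:R.

Section TranslationMatrices.
Variables (K : numClosedFieldType) (G : finZmodType).
Local Notation T := (@translation_mx K G).

Lemma translation_mx0 : T 0 = 1%:M.
Proof.
by apply/matrixP=> i j; rewrite !mxE addr0 (inj_eq enum_val_inj).
Qed.

Lemma translation_mxD g h : T (g + h) = T g *m T h.
Proof.
apply/matrixP=> i j; rewrite !mxE (bigD1 (enum_rank (enum_val i + g))) //=.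
rewrite big1 => [|k ne_k]; rewrite !mxE.
  by rewrite enum_rankK eqxx mul1r addr0 addrA.
have -> : (enum_val i + g == enum_val k) = false; last by rewrite mul0r.
by apply: contraNF ne_k => /eqP->; rewrite enum_valK.
Qed.

Lemma mxtrace_translation g : \tr (T g) = (#|G| * (g == 0))%:R.
Proof.
rewrite /mxtrace (eq_bigr (fun=> (g == 0)%:R)) => [|i _].
  by rewrite sumr_const card_ord natrM mulr_natl.
by rewrite mxE -{2}[enum_val i]addr0 (inj_eq (addrI _)).
Qed.

Lemma translation_mx_iter g k :
  iter k (mulmx (T g)) 1%:M = T (g *+ k).
Proof.
elim: k => [|k /= ->]; first by rewrite mulr0n translation_mx0.
by rewrite mulrS translation_mxD.
Qed.

End TranslationMatrices.

Section CharacterFamily.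
Variables (K : numClosedFieldType) (G : finZmodType).

(** As [g *+ #|G| = 0], the minimal polynomial divides ['X^#|G| - 1], which is separable in
    characteristic 0. *)
Lemma translation_mx_diagonalizable (g : G) : diagonalizable (translation_mx K g).
Proof.
have n_gt0 : (0 < #|G|)%N by apply/card_gt0P; exists 0.
have := @translation_mx_iter K G g #|G|.
rewrite finZmod_mulrn translation_mx0; move: (translation_mx K g) => {g}.
case: #|G| n_gt0 => // n _ A A1; apply/diagonalizableP.
have [rs Drs] := closed_field_poly_normal ('X^(n.+1) - 1 : {poly K}).
have mon : ('X^(n.+1) - 1 : {poly K}) \is monic by rewrite -[1]/(1%:P) monicXnsubC.
rewrite (monicP mon) scale1r in Drs.
exists rs; last first.
  rewrite -Drs; apply: mxminpoly_min.
  have expA k : A ^+ k = iter k (mulmx A) 1%:M.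
    by elim: k => [|k IHk]; rewrite ?expr0 // exprS IHk.
  by rewrite rmorphB rmorphXn /= horner_mx_X rmorph1 expA A1 subrr.
by rewrite -separable_prod_XsubC -Drs separable_Xn_sub_1 // pnatr_eq0.
Qed.

(** The commuting translation matrices are diagonalized simultaneously; each diagonal position
    yields a character, and the trace gives the orthogonality relation. *)
Lemma exists_character_family :
  exists X : 'I_#|G| -> G -> K,
    (forall i, additive_character (X i)) /\
    forall g, \sum_i X i g = (#|G| * (g == 0))%:R.
Proof.
pose Ts := [seq translation_mx K g | g : G].
have /codiagonalizableP[P Pu /allP PTs] :
    {in Ts &, forall A B, comm_mx A B} /\ {in Ts, forall A, diagonalizable A}.
  split=> [A B /fintype.imageP[g _ ->] /fintype.imageP[h _ ->]|
           A /fintype.imageP[g _ ->]].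
    by rewrite /comm_mx -!translation_mxD addrC.
  exact: translation_mx_diagonalizable.
have diagT g : is_diag_mx (P *m translation_mx K g *m invmx P).
  by rewrite -conjumx //; apply: PTs; apply: fintype.image_f.
pose D g := P *m translation_mx K g *m invmx P.
exists (fun i g => D g i i); split=> [i|g].
  split=> [|g h]; first by rewrite /D translation_mx0 mulmx1 mulmxV // mxE eqxx.
  have -> : D (g + h) = D g *m D h.
    by rewrite /D translation_mxD -!mulmxA; congr (_ *m _);
       rewrite !mulmxA mulmxKV.
  rewrite mxE (bigD1 i) //= big1 ?addr0 // => j ne_ji.
  by rewrite [D g i j](is_diag_mxP (diagT g)) ?mul0r // eq_sym.
rewrite -/(\tr (D g)) /D -mulmxA mxtrace_mulC -mulmxA mulVmx // mulmx1.
exact: mxtrace_translation.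
Qed.
End CharacterFamily.

Section Characters.
Variables (K : numClosedFieldType) (G : finZmodType).
Implicit Types (chi psi : G -> K) (x y : G).

Lemma character_mulrn chi (chiP : additive_character chi) x k :
  chi (x *+ k) = chi x ^+ k.
Proof.
case: chiP => chi0 chiD; elim: k => [|k IHk]; first by rewrite mulr0n.
by rewrite mulrS chiD IHk exprS.
Qed.

Lemma character_order chi (chiP : additive_character chi) x :
  chi x ^+ #|G| = 1.
Proof. by rewrite -character_mulrn // finZmod_mulrn; case: chiP. Qed.

Lemma card_finZmod_gt0 : (0 < #|G|)%N.
Proof. by apply/card_gt0P; exists 0. Qed.

Lemma character_norm chi (chiP : additive_character chi) x : `|chi x| = 1.
Proof.
apply/eqP; rewrite -(@pexpr_eq1 _ _ #|G|) ?card_finZmod_gt0 //.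
by rewrite -normrX character_order // normr1.
Qed.

Lemma character_neq0 chi (chiP : additive_character chi) x : chi x != 0.
Proof. by rewrite -normr_eq0 character_norm ?oner_eq0. Qed.

Lemma characterNV chi (chiP : additive_character chi) x :
  chi (- x) = (chi x)^-1.
Proof.
apply: (mulfI (character_neq0 chiP x)); rewrite mulfV ?character_neq0 //.
by case: chiP => chi0 <-; rewrite subrr.
Qed.

Lemma characterN chi (chiP : additive_character chi) x :
  chi (- x) = (chi x)^*.
Proof. by rewrite characterNV // invC_norm character_norm // expr1n invr1 mul1r. Qed.

Lemma trivial_character : additive_character (fun _ : G => 1 : K).
Proof. by split=> // x y; rewrite mulr1. Qed.

Lemma characterM chi psi :
  additive_character chi -> additive_character psi ->
  additive_character (fun x => chi x * psi x).
Proof.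
move=> [chi0 chiD] [psi0 psiD].
by split=> [|x y]; rewrite ?chi0 ?psi0 ?mulr1 // chiD psiD mulrACA.
Qed.

Lemma character_comp chi (f : G -> G) :
    additive_character chi -> f 0 = 0 -> {morph f : x y / x + y} ->
  additive_character (chi \o f).
Proof. by move=> [chi0 chiD] f0 fD; split=> [|x y] /=; rewrite ?f0 // fD chiD. Qed.

Lemma sum_character chi (chiP : additive_character chi) x :
  chi x != 1 -> \sum_y chi y = 0.
Proof.
move=> chix; apply/eqP; have: (chi x - 1) * \sum_y chi y == 0.
  rewrite mulrBl mul1r mulr_sumr [X in _ - X](reindex_inj (addrI x)) /=.
  by rewrite (eq_bigr (fun y => chi (x + y))) ?subrr // => y _; case: chiP.
by rewrite mulf_eq0 subr_eq0 (negPf chix).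
Qed.

Section Family.
Variable X : 'I_#|G| -> G -> K.
Hypothesis charX : forall i, additive_character (X i).
Hypothesis sumX : forall g, \sum_i X i g = (#|G| * (g == 0))%:R.

Lemma card_neq0 : #|G|%:R != 0 :> K.
Proof. by rewrite pnatr_eq0 -lt0n card_finZmod_gt0. Qed.

Lemma fourier_inversion (f : G -> K) x :
  \sum_i (\sum_y f y * X i y) * X i (- x) = #|G|%:R * f x.
Proof.
under eq_bigr do rewrite mulr_suml.
rewrite exchange_big /= (bigD1 x) //= [X in _ + X]big1 => [|y ne_yx].
  under eq_bigr do rewrite -mulrA -(charX _).2 subrr.
  by rewrite -mulr_sumr sumX eqxx muln1 addr0 mulrC.
under eq_bigr do rewrite -mulrA -(charX _).2.
by rewrite -mulr_sumr sumX subr_eq0 (negPf ne_yx) muln0 mulr0.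
Qed.

(** If [chi] differed from every [X i], all Fourier coefficients of [x |-> chi (- x)] would be sums
    of nontrivial characters, hence 0; inversion at 0 would then contradict [chi 0 = 1]. *)
Lemma character_family_complete chi :
  additive_character chi -> exists i, chi =1 X i.
Proof.
move=> chiP; pose chi' x := chi (- x).
have [/existsP[i /forallP Ei]|] := boolP [exists i, forall x, chi x == X i x].
  by exists i => x; apply/eqP.
move=> /existsPn noX; have /esym/eqP := fourier_inversion chi' 0.
rewrite big1 => [|i _].
  by rewrite mulf_eq0 (negPf card_neq0) /chi' oppr0 chiP.1 oner_eq0.
have /forallPn[x ne_x] := noX i; rewrite (@sum_character _ _ x) ?mul0r //.
  apply: characterM => //; apply: (@character_comp _ (fun x => - x)) => //.
    by rewrite oppr0.
  by move=> y z; rewrite opprD.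
rewrite /chi' characterNV //; apply: contra ne_x => /eqP chiX.
by apply/eqP; rewrite -[RHS](mulVKf (character_neq0 chiP x)) chiX mulr1.
Qed.

Lemma character_family_separates x : (forall i, X i x = 1) -> x = 0.
Proof.
move=> X1; have := sumX x; rewrite (eq_bigr _ (fun i _ => X1 i)) sumr_const card_ord.
case: eqP => // _; rewrite muln0 => /eqP.
by rewrite (negPf card_neq0).
Qed.
End Family.
End Characters.

(** * Galois conjugation *)

Section Galois.
Variable K : numClosedFieldType.

Lemma rat_intr_poly (L : numFieldType) (p : {poly int}) :
  map_poly (intr : int -> L) p = map_poly ratr (map_poly (intr : int -> rat) p).
Proof. by rewrite -map_poly_comp; apply: eq_map_poly => a /=; rewrite ratr_int. Qed.

(** As a root of ['X^n - 1], [z] is a root of some ['Phi_d] with [d] dividing [n]; then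
    [z ^+ d = 1], and primitivity forces [d = n]. *)
Lemma root_Cyclotomic_prim (n : nat) (z : K) :
  n.-primitive_root z -> root (map_poly intr ('Phi_n)) z.
Proof.
move=> prim_z; have n_gt0 := prim_order_gt0 prim_z.
have : root (map_poly intr (\prod_(d <- divisors n) 'Phi_d)) z.
  rewrite prod_Cyclotomic // rmorphB rmorph1 /= map_polyXn /root !hornerE.
  by rewrite prim_expr_order // subrr.
rewrite rmorph_prod /= /root horner_prod prodf_seq_eq0.
case/hasP=> d; rewrite -dvdn_divisors //= => d_n; rewrite -/(root _ z) => rootd.
suff /eqP <- : d == n by [].
rewrite eqn_dvd d_n (prim_order_dvd prim_z) /=.
have d_gt0 : (0 < d)%N by apply: dvdn_gt0 d_n.
have : root (map_poly intr (\prod_(e <- divisors d) 'Phi_e)) z.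
  rewrite (big_rem d) /= ?rmorphM ?rootM ?rootd //.
  by rewrite -dvdn_divisors.
by rewrite prod_Cyclotomic // rmorphB rmorph1 /= map_polyXn /root !hornerE subr_eq0.
Qed.

Lemma Cyclotomic_dvdp_rat (n : nat) (w : algC) (p : {poly rat}) :
    n.-primitive_root w -> root (map_poly ratr p) w ->
  map_poly intr ('Phi_n) %| p.
Proof.
move=> prim_w; have [q [Dq mon_q] ->] := minCpolyP w.
suff -> : q = map_poly intr 'Phi_n by [].
apply: (map_inj_poly (fmorph_inj (@ratr algC)) (rmorph0 _)).
by rewrite -rat_intr_poly -Dq (minCpoly_cyclotomic prim_w) (Cintr_Cyclotomic prim_w).
Qed.

(** ['Phi_n] has the root [z] in common with [p] and is irreducible over the rationals, so it
    divides [p]; and [z ^+ s] is again a root of ['Phi_n]. *)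
Lemma prim_root_conjugate (n s : nat) (z : K) (p : {poly int}) :
    n.-primitive_root z -> coprime s n ->
  root (map_poly intr p) z -> root (map_poly intr p) (z ^+ s).
Proof.
move=> prim_z co_sn pz.
have Phiz := root_Cyclotomic_prim prim_z.
have Phizs : root (map_poly intr 'Phi_n) (z ^+ s).
  by apply: root_Cyclotomic_prim; rewrite prim_root_exp_coprime.
move: Phiz Phizs pz; rewrite !(rat_intr_poly K) => Phiz Phizs.
set F := map_poly intr p => pz; set Phi := map_poly intr 'Phi_n in Phiz Phizs.
suff /dvdpP[q ->] : Phi %| F by rewrite rmorphM rootM Phizs orbT.
(* Coprimality of rational polynomials does not depend on the extension: the common root [z] in [K]
   yields a common root [w] in [algC], where ['Phi_n] is known to be a minimal polynomial. *)
have [co|nco] := boolP (coprimep F Phi).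
  move: co; rewrite -(coprimep_map (@ratr K)) => /coprimep_root/(_ pz).
  by rewrite -rootE Phiz.
have /closed_rootP[w] : size (map_poly (ratr : rat -> algC) (gcdp F Phi)) != 1%N.
  by rewrite size_map_poly.
rewrite gcdp_map root_gcd => /andP[Fw Phiw].
apply: (@Cyclotomic_dvdp_rat n w) => //.
have [z0 prim0] := C_prim_root_exists (prim_order_gt0 prim_z).
by rewrite -(root_cyclotomic prim0) -(Cintr_Cyclotomic prim0) rat_intr_poly.
Qed.

Lemma integral_ratr (q : rat) :
  integralOver (intr : int -> K) (ratr q) -> q \is a Num.int.
Proof.
case=> p mon_p; rewrite rat_intr_poly fmorph_root => pq.
rewrite -Cint_rat; apply: Cint_rat_Aint; first exact: Crat_rat.
apply: (@root_monic_Aint (map_poly intr p)).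
- by rewrite rat_intr_poly fmorph_root.
- by rewrite monic_map.
by apply/polyOverP => i; rewrite coef_map /= intr_int.
Qed.

Lemma integral_sum (I : Type) (r : seq I) (P : pred I) (F : I -> K) :
    (forall i, P i -> integralOver (intr : int -> K) (F i)) ->
  integralOver (intr : int -> K) (\sum_(i <- r | P i) F i).
Proof.
move=> intF; apply: (big_ind _ _ _ intF); first exact: mxpoly.integral0.
exact: integral_add.
Qed.

Lemma integral_unity_root (n : nat) (z : K) :
  (0 < n)%N -> z ^+ n = 1 -> integralOver (intr : int -> K) z.
Proof.
move=> n_gt0 zn; exists ('X^n - 1); first by rewrite -[1]/(1%:P) monicXnsubC.
by rewrite rmorphB rmorph1 /= map_polyXn /root !hornerE zn subrr.
Qed.
End Galois.

(** * Subsets with integral character sums *)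

Section ConnectionSets.
Variables (K : numClosedFieldType) (G : finZmodType).

Lemma exists_prim_root n : (0 < n)%N -> exists z : K, n.-primitive_root z.
Proof.
move=> n_gt0; have [rs Drs] := closed_field_poly_normal ('X^n - 1 : {poly K}).
have mon : ('X^n - 1 : {poly K}) \is monic by rewrite -[1]/(1%:P) monicXnsubC.
rewrite (monicP mon) scale1r in Drs.
have /hasP[z _ prim_z] : has n.-primitive_root rs.
  apply: has_prim_root => //.
  - apply/allP => z zrs; rewrite /root_of_unity Drs root_prod_XsubC //.
  - rewrite -separable_prod_XsubC -Drs separable_Xn_sub_1 //.
    by rewrite pnatr_eq0 -lt0n.
  have := size_prod_XsubC rs id; rewrite -Drs size_XnsubC // => -[<-].
  exact: leqnn.
by exists z.
Qed.

(** The character sums are the Fourier coefficients of the indicator function, which inversion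
    recovers. *)
Lemma sum_characters_inj (A B : {set G}) :
    (forall chi : G -> K, additive_character chi ->
       \sum_(c in A) chi c = \sum_(c in B) chi c) ->
  A = B.
Proof.
have [X [charX sumX]] := exists_character_family K G.
move=> eqAB; apply/setP => x.
have inv (D : {set G}) :
    \sum_i (\sum_(c in D) X i c) * X i (- x) = (#|G| * (x \in D))%:R.
  rewrite natrM -(fourier_inversion charX sumX (fun y => (y \in D)%:R)).
  apply: eq_bigr => i _; congr (_ * _); rewrite big_mkcond.
  by apply: eq_bigr => y _; case: (y \in D); rewrite ?mul1r ?mul0r.
have /eqP : (#|G| * (x \in A))%:R = (#|G| * (x \in B))%:R :> K.
  by rewrite -!inv; apply: eq_bigr => i _; rewrite eqAB.
rewrite eqr_nat eqn_pmul2l ?card_finZmod_gt0 //.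
by case: (x \in A); case: (x \in B).
Qed.

Variable C : {set G}.
Hypothesis intC : forall chi : G -> K, additive_character chi ->
  exists l : int, \sum_(c in C) chi c = l%:~R.

(** All values of [chi] are powers of one primitive root [z], so the integrality of the sum is an
    integer polynomial relation in [z], which [z ^+ s] satisfies too. *)
Lemma sum_character_conjugate (chi : G -> K) s :
    additive_character chi -> coprime s #|G| ->
  \sum_(c in C) chi (c *+ s) = \sum_(c in C) chi c.
Proof.
move=> chiP co_s; have [z prim_z] := exists_prim_root (card_finZmod_gt0 G).
have expo c : {k : 'I_#|G| | chi c = z ^+ k}.
  exact: (prim_rootP prim_z (character_order chiP c)).
pose d c := sval (expo c); have chiE c : chi c = z ^+ d c := svalP (expo c).
have [l El] := intC chiP.
pose p : {poly int} := \sum_(c in C) 'X^(d c) - l%:P.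
have pE w : (map_poly intr p).[w] = \sum_(c in C) w ^+ d c - l%:~R :> K.
  rewrite rmorphB rmorph_sum /= map_polyC /= !hornerE horner_sum.
  by congr (_ - _); apply: eq_bigr => c _; rewrite map_polyXn hornerXn.
have rootz : root (map_poly intr p) z.
  by rewrite /root pE -El subr_eq0; apply/eqP/eq_bigr => c _; rewrite chiE.
have := prim_root_conjugate prim_z co_s rootz.
rewrite /root pE subr_eq0 El => /eqP <-; apply: eq_bigr => c _.
by rewrite character_mulrn // chiE -!exprM mulnC.
Qed.

Lemma order_dvdn_mulrn (x : G) k : (#[x]%g %| k)%N = (x *+ k == 0).
Proof. exact: order_dvdn. Qed.

Lemma coprime_mulrn_inj s : coprime s #|G| -> injective (fun x : G => x *+ s).
Proof.
move=> co_s x y /= /eqP; rewrite -subr_eq0 -mulrnBl -order_dvdn_mulrn => o_s.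
apply/eqP; rewrite -subr_eq0 -[x - y]mulr1n -order_dvdn_mulrn.
by rewrite -(eqP co_s) dvdn_gcd o_s order_dvdn_mulrn finZmod_mulrn eqxx.
Qed.

(* Integral eigenvalues are fixed by the Galois action [zeta |-> zeta ^+ s]. *)
Lemma connection_set_mulrn c s : coprime s #|G| -> c \in C -> c *+ s \in C.
Proof.
move=> co_s Cc; have inj_s := coprime_mulrn_inj co_s.
have <- : [set x *+ s | x in C] = C; last exact: imset_f.
apply: sum_characters_inj => chi chiP; rewrite big_imset; last exact: in2W.
exact: sum_character_conjugate.
Qed.
End ConnectionSets.

(** * The 2-part *)

Lemma dvdz_exp2_odd k (x o : int) :
  odd `|o| -> ((2 ^ k)%N %| x * o)%Z -> ((2 ^ k)%N %| x)%Z.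
Proof.
by move=> odd_o; rewrite Gauss_dvdzl // coprimezE coprimeXl // coprime2n.
Qed.

Lemma addr_eqr (V : zmodType) (x y : V) : (x + y == y) = (x == 0).
Proof. by rewrite -[LHS]subr_eq0 addrK. Qed.

Lemma sum_antiperiodic (K : numDomainType) (G : finZmodType) (a : G)
    (P : pred G) (F : G -> K) :
    (forall x, P (x + a) = P x) -> (forall x, P x -> F (x + a) = - F x) ->
  \sum_(x | P x) F x = 0.
Proof.
move=> Pa Fa; apply/eqP; rewrite -[_ == 0](mulrn_eq0 _ 2) mulr2n.
rewrite {1}(reindex_inj (addIr a)) /= (eq_bigl _ _ Pa) -big_split /=.
by rewrite big1 // => x Px; rewrite Fa // addNr.
Qed.

Section CyclicTwoPart.
Variables (K : numClosedFieldType) (G : finZmodType) (C : {set G}).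
Hypothesis intC : forall chi : G -> K, additive_character chi ->
  exists l : int, \sum_(c in C) chi c = l%:~R.

(* [x |-> x *+ e] is the projection of [G] onto its Sylow 2-subgroup, whose
   only element of order two is [a]. *)
Variables (a : G) (e m : nat).
Hypothesis a_neq0 : a != 0.
Hypothesis a2 : a *+ 2 = 0.
Hypothesis invol : forall x : G, x *+ 2 = 0 -> x = 0 \/ x = a.
Hypothesis e2m : forall x : G, x *+ e *+ (2 ^ m) = 0.
Hypothesis ea : a *+ e = a.
Hypothesis ee : forall x : G, x *+ e *+ e = x *+ e.
Hypothesis coprime_e : forall k, coprime (k * e).*2.+1 #|G|.

(** Among the successive doubles of [z], the last nonzero one is an involution. *)
Lemma two_torsion_multiple j (z : G) :
  z *+ (2 ^ j) = 0 -> z != 0 -> exists k, z *+ k = a.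
Proof.
elim: j => [|j IHj]; first by rewrite expn0 mulr1n => ->; rewrite eqxx.
have [zj _|zj + _] := eqVneq (z *+ (2 ^ j)) 0; first exact: IHj.
rewrite expnSr mulrnA => /invol[zj0|zja]; first by rewrite zj0 eqxx in zj.
by exists (2 ^ j)%N.
Qed.

(** This is multiplication by the unit [(k * e).*2.+1], which fixes the odd component of [x]. *)
Lemma connection_set_shift x k : x \in C -> x + x *+ e *+ k.*2 \in C.
Proof.
move=> /(connection_set_mulrn intC (coprime_e k)).
by rewrite mulrS -mulrnA -doubleMr (mulnC e).
Qed.

Let addaa : a + a = 0. Proof. by rewrite -mulr2n. Qed.

Let oppa : - a = a. Proof. by apply/esym/eqP; rewrite -addr_eq0 addaa. Qed.

(** The 2-component of [x] has order at least 4, so [a] is an even multiple of it. The converse adds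
    [a] once more. *)
Lemma shift_a x : x *+ e != 0 -> x *+ e != a -> (x + a \in C) = (x \in C).
Proof.
have fwd y : y *+ e != 0 -> y *+ e != a -> y \in C -> y + a \in C.
  move=> y0 ya Cy; have y2 : y *+ e *+ 2 != 0.
    by apply/eqP => /invol[]; apply/eqP.
  have [|k <-] := @two_torsion_multiple m _ _ y2.
    by rewrite mulrnAC e2m mul0rn.
  by rewrite -mulrnA mul2n; apply: connection_set_shift.
move=> x0 xa; apply/idP/idP; last exact: fwd.
rewrite -[X in _ -> X \in C]addr0 -addaa addrA; apply: fwd; rewrite mulrnDl ea.
  by rewrite addr_eq0 oppa.
by rewrite -subr_eq0 addrK.
Qed.

(** The 2-component of [x] has order at least 8, so some even multiple of it doubles to [a], as [q]
    does; the two differ by 0 or [a]. *)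
Lemma shift_quarter q x :
    q *+ 2 = a -> q *+ e = q -> x *+ e *+ 2 != 0 -> x *+ e *+ 2 != a ->
  (x + q \in C) = (x \in C).
Proof.
have fwd r y : r *+ 2 = a -> r *+ e = r -> y *+ e *+ 2 != 0 -> y *+ e *+ 2 != a ->
    y \in C -> y + r \in C.
  move=> r2 re y0 ya Cy; have y4 : y *+ e *+ 4 != 0.
    by rewrite (mulrnA _ 2 2); apply/eqP => /invol[]; apply/eqP.
  have [|k Ek] := @two_torsion_multiple m _ _ y4.
    by rewrite mulrnAC e2m mul0rn.
  have : (y *+ e *+ k.*2 - r) *+ 2 = 0.
    by rewrite mulrnBl r2 -mulrnA -mul2n mulnAC mulrnA Ek subrr.
  case/invol=> /eqP; rewrite subr_eq.
    by rewrite add0r => /eqP <-; apply: connection_set_shift.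
  (* Here the multiple found is [a + r]; its triple is [r], since [a *+ 3 = a] and
     [r *+ 3 = r + a]. *)
  move=> /eqP Er; have <- : y *+ e *+ (k * 3).*2 = r.
    rewrite doubleMl mulrnA Er mulrnDl (mulrSr _ 2) a2 add0r.
    by rewrite (mulrSr _ 2) r2 addrA addaa add0r.
  exact: connection_set_shift.
move=> q2 qe x0 xa; apply/idP/idP; last exact: fwd.
rewrite -[X in _ -> X \in C](addrK q); apply: fwd.
- by rewrite mulNrn q2 oppa.
- by rewrite mulNrn qe.
- by rewrite !mulrnDl qe q2 addr_eq0 oppa.
by rewrite !mulrnDl qe q2 -subr_eq0 addrK.
Qed.

(* At most one solution of [q *+ 2 = a] in the 2-part is retained; the only other
   one is [- q]. The set is empty if the 2-part has order two. *)
Definition quarter : {set G} :=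
  if [pick q | (q *+ 2 == a) && (q *+ e == q)] is Some q then [set q]
  else finset.set0.

Definition gap (y : G) : int :=
  (y + a \in C)%:Z - \sum_(q in quarter) (y + q \in C)%:Z.

Lemma gap_bounds y : (-1 <= gap y <= 1)%R.
Proof.
rewrite /gap /quarter; case: pickP => [q _|_]; rewrite ?big_set1 ?big_set0.
  by case: (_ \in C); case: (_ \in C).
by case: (_ \in C).
Qed.

Section Gap.
Variables beta psi : G -> K.
Hypothesis charb : additive_character beta.
Hypothesis charp : additive_character psi.
Hypothesis beta_e : forall x, beta (x *+ e) = beta x.
Hypothesis beta_a : beta a = -1.
Hypothesis psi_e : forall x, psi (x *+ e) = 1.

Let psi_a : psi a = 1. Proof. by rewrite -ea. Qed.

(** The elements of the 2-part that double to [a] are [q] and [q + a]. Translation by [a] exchanges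
    their cosets, preserves [C] there by [shift_a], and leaves [psi] unchanged. *)
Lemma sum_quarter :
  \sum_(c in C | c *+ e *+ 2 == a) psi c =
  2 * \sum_(c in C | c *+ e \in quarter) psi c.
Proof.
rewrite /quarter; case: pickP => [q /andP[/eqP q2 /eqP qe]|noq]; last first.
  rewrite [X in 2 * X]big_pred0 => [|c]; last by rewrite inE andbF.
  rewrite big_pred0 ?mulr0 // => c.
  by apply/negP => /andP[_ /eqP ca]; have /= := noq (c *+ e); rewrite ca ee !eqxx.
have q_neq0 : q != 0 by apply/eqP => q0; move: a_neq0; rewrite -q2 q0 mul0rn eqxx.
have q_neqa : q != a by apply/eqP => qa; move: a_neq0; rewrite -q2 qa a2 eqxx.
rewrite (bigID (fun c => c *+ e == q)) /= mulrDl mul1r; congr (_ + _).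
  apply: eq_bigl => c; rewrite inE -andbA; congr (_ && _).
  by case: (c *+ e =P q) => [->|_]; rewrite ?andbF // q2 eqxx.
rewrite (reindex_inj (addIr a)) /=; apply: eq_big => c; last first.
  by rewrite charp.2 psi_a mulr1.
rewrite !inE mulrnDl ea mulrnDl a2 addr0 -andbA.
have [cq|ncq] := eqVneq (c *+ e) q.
  rewrite (shift_a (x := c)) ?cq // q2 eqxx -[X in _ != X]addr0 (inj_eq (addrI _)).
  by rewrite a_neq0 !andbT.
rewrite andbF; apply/negP => /and3P[_ /eqP ca /negP[]].
have : (c *+ e - q) *+ 2 = 0 by rewrite mulrnBl ca q2 subrr.
case/invol => /eqP; rewrite subr_eq ?add0r ?(negPf ncq) // => /eqP->.
by rewrite addrAC addaa add0r.
Qed.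

Lemma sum_translate z : z *+ e = z ->
  \sum_(c in C | c *+ e == z) psi c =
  \sum_(y | y *+ e == 0) (y + z \in C)%:R * psi y.
Proof.
move=> ze; rewrite (reindex_inj (addIr z)) [RHS]big_mkcond [LHS]big_mkcond /=.
apply: eq_bigr => y _; rewrite mulrnDl ze addr_eqr charp.2.
rewrite -{2}ze psi_e mulr1.
by case: (_ \in C); case: (_ == 0); rewrite ?mul1r ?mul0r.
Qed.

Lemma betaM2 x : beta x ^+ 2 = beta (x *+ e *+ 2).
Proof. by rewrite -mulrnA mulnC mulrnA beta_e character_mulrn. Qed.

(** Where the 2-component is neither 0 nor [a], translation by [a] preserves [C] and negates
    [beta * psi], so the terms cancel. *)
Lemma sum_beta :
  \sum_(c in C) beta c * psi c =
  \sum_(c in C | c *+ e == 0) psi c - \sum_(c in C | c *+ e == a) psi c.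
Proof.
rewrite (bigID (fun c => c *+ e == 0)) /=; congr (_ + _).
  by apply: eq_bigr => c /andP[_ /eqP c0]; rewrite -beta_e c0 charb.1 mul1r.
rewrite (bigID (fun c => c *+ e == a)) /=.
rewrite [X in _ + X](@sum_antiperiodic _ _ a) ?addr0.
- rewrite -sumrN; apply: eq_big => c.
    by have [->|] := eqVneq (c *+ e) a; rewrite ?andbF // a_neq0 !andbT.
  by case/andP => _ /eqP ca; rewrite -beta_e ca beta_a mulN1r.
- move=> x; rewrite mulrnDl ea addr_eqr.
  rewrite addr_eq0 oppa.
  have [xa|xna] := eqVneq (x *+ e) a; first by rewrite !andbF.
  have [x0|xn0] := eqVneq (x *+ e) 0; first by rewrite !andbF.
  by rewrite shift_a.
by move=> x _; rewrite charb.2 charp.2 beta_a psi_a mulr1 mulrN1 mulNr.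
Qed.

(** [beta ^+ 2] is 1 where the 2-component has order at most 2 and -1 where it has order 4. Beyond
    order 4, translation by [q] preserves [C] and negates the terms, as [beta q ^+ 2 = beta a]. *)
Lemma sum_beta2 :
  \sum_(c in C) beta c ^+ 2 * psi c =
  \sum_(c in C | c *+ e == 0) psi c + \sum_(c in C | c *+ e == a) psi c
  - 2 * \sum_(c in C | c *+ e \in quarter) psi c.
Proof.
rewrite (bigID (fun c => c *+ e *+ 2 == 0)) /=; congr (_ + _).
  rewrite (bigID (fun c => c *+ e == 0)) /=; congr (_ + _).
    apply: eq_big => c.
      by have [->|] := eqVneq (c *+ e) 0; rewrite ?andbF // mul0rn eqxx !andbT.
    by case/andP => _ /eqP c0; rewrite betaM2 c0 mul0rn charb.1 mul1r.
  apply: eq_big => c; last first.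
    by case/andP => /andP[_ /eqP c0] _; rewrite betaM2 c0 charb.1 mul1r.
  rewrite -andbA; congr (_ && _); apply/andP/eqP => [[/eqP/invol[->|//]]|->].
    by rewrite eqxx.
  by rewrite a2 a_neq0.
rewrite -sum_quarter -sumrN (bigID (fun c => c *+ e *+ 2 == a)) /=.
rewrite [X in _ + X](_ : _ = 0) ?addr0.
  apply: eq_big => c.
    by have [->|] := eqVneq (c *+ e *+ 2) a; rewrite ?andbF // a_neq0 !andbT.
  by case/andP => _ /eqP ca; rewrite betaM2 ca beta_a mulN1r.
(* Without such a [q] there is nothing to sum: a 2-component of order at least 8 would have one as a
   multiple. *)
have [/existsP[q /andP[/eqP q2 /eqP qe]]|/existsPn noq] :=
  boolP [exists q, (q *+ 2 == a) && (q *+ e == q)]; last first.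
  rewrite big_pred0 // => c; apply/negP => /andP[/andP[_ c0] ca].
  have c4 : c *+ e *+ 2 *+ 2 != 0 by apply/eqP => /invol[]; apply/eqP.
  have [|k Ek] := @two_torsion_multiple m _ _ c4.
    by rewrite -(mulrnA _ 2 2) mulrnAC e2m mul0rn.
  have := noq (c *+ e *+ 2 *+ k); rewrite mulrnAC Ek eqxx /=.
  by rewrite (mulrnAC _ k e) (mulrnAC _ 2 e) ee eqxx.
apply: (@sum_antiperiodic _ _ q) => x.
  rewrite !mulrnDl qe q2 addr_eqr.
  rewrite addr_eq0 oppa.
  have [xa|xna] := eqVneq (x *+ e *+ 2) a; first by rewrite !andbF.
  have [x0|xn0] := eqVneq (x *+ e *+ 2) 0; first by rewrite !andbF.
  by rewrite (shift_quarter q2 qe).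
move=> _; rewrite charp.2 charb.2 -{2}qe psi_e mulr1 exprMn.
by rewrite -[beta q ^+ 2]character_mulrn // q2 beta_a mulrN1 mulNr.
Qed.

Lemma eigenvalue_gap :
  \sum_(c in C) beta c ^+ 2 * psi c - \sum_(c in C) beta c * psi c =
  2 * \sum_(y | y *+ e == 0) (gap y)%:~R * psi y.
Proof.
have -> : \sum_(y | y *+ e == 0) (gap y)%:~R * psi y =
  \sum_(c in C | c *+ e == a) psi c - \sum_(c in C | c *+ e \in quarter) psi c.
  rewrite (sum_translate ea) /gap /quarter.
  case: pickP => [q /andP[_ /eqP qe]|_].
    under [X in _ = _ - X]eq_bigl do rewrite inE.
    rewrite (sum_translate qe) -sumrB; apply: eq_bigr => y _.
    by rewrite big_set1 rmorphB /= mulrBl.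
  rewrite [X in _ - X]big_pred0 ?subr0; last by move=> c; rewrite inE andbF.
  by apply: eq_bigr => y _; rewrite big_set0 subr0.
by rewrite sum_beta sum_beta2; ring.
Qed.

End Gap.

(** By Cauchy's theorem an even order would put the involution [a] in the kernel, but
    [a *+ e = a]. *)
Lemma odd_card_kernel : odd #|[set p : G | p *+ e == 0]|.
Proof.
have gK : group_set [set p : G | p *+ e == 0].
  apply/group_setP; split=> [|x y]; first by rewrite inE mul0rn.
  by rewrite !inE => /eqP x0 /eqP y0; rewrite mulrnDl x0 y0 addr0.
rewrite -[odd _]negbK -dvdn2; apply/negP => /(@Cauchy _ 2 (group gK) isT)[x].
rewrite inE => /eqP x0 ox.
have /invol[xx0|xa] : x *+ 2 = 0.
  by apply/eqP; rewrite -order_dvdn_mulrn ox.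
  by move: ox; rewrite xx0 order1.
by case/eqP: a_neq0; rewrite -ea -xa.
Qed.

(** * Fourier inversion on the odd part *)

Section Inversion.
Variable X : 'I_#|G| -> G -> K.
Hypothesis charX : forall i, additive_character (X i).
Hypothesis sumX : forall g, \sum_i X i g = (#|G| * (g == 0))%:R.

(** Orthogonality on the odd part: summing [X i (x + p *+ e)] over [p] kills exactly the characters
    that are nontrivial on the 2-part. *)
Lemma sum_trivial_two_part x : x *+ e = 0 ->
  \sum_(i | [forall y, X i (y *+ e) == 1]) X i x =
  (#|[set p : G | p *+ e == 0]| * (x == 0))%:R.
Proof.
move=> xe; apply: (mulfI (card_neq0 K G)); rewrite -natrM.
transitivity (\sum_p \sum_i X i (x + p *+ e)); last first.
  under eq_bigr do rewrite sumX; rewrite -natr_sum -big_distrr /=.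
  congr ((_ * _)%:R); have [->|x0] := eqVneq x 0.
    rewrite muln1 -sum1_card [RHS]big_mkcond /=; apply: eq_bigr => p _.
    by rewrite inE add0r; case: eqP.
  rewrite muln0 big1 // => p _; case: (x + p *+ e =P 0) => // xp.
  have pe : p *+ e = 0 by rewrite -ee -[LHS]add0r -xe -mulrnDl xp mul0rn.
  by move: xp; rewrite pe addr0 => /eqP; rewrite (negPf x0).
rewrite exchange_big mulr_sumr big_mkcond; apply: eq_bigr => i _.
under [RHS]eq_bigr do rewrite (charX i).2; rewrite -mulr_sumr.
have cXe : additive_character (X i \o (fun p => p *+ e)).
  apply: character_comp => //; first by rewrite mul0rn.
  by move=> u v; rewrite mulrnDl.
case: ifPn => [/forallP X1|/forallPn[y /(sum_character cXe) /= ->]].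
  by under [in RHS]eq_bigr do rewrite (eqP (X1 _)); rewrite sumr_const mulrC.
by rewrite mulr0.
Qed.

(** Inversion on the odd part, of order [N], shows that [gap y * N / 2] is an algebraic integer. It
    is rational, so [gap y * N] is even; [N] is odd and [gap y] is at most 1 in absolute value. *)
Lemma gap_eq0 y :
    (forall psi : G -> K,
       additive_character psi -> (forall x, psi (x *+ e) = 1) ->
       exists z : int, \sum_(x | x *+ e == 0) (gap x)%:~R * psi x = z%:~R * 2) ->
  y *+ e = 0 -> gap y = 0.
Proof.
move=> even_gap ye; pose N := #|[set p : G | p *+ e == 0]|.
have invN : \sum_(i | [forall x, X i (x *+ e) == 1])
    (\sum_(x | x *+ e == 0) (gap x)%:~R * X i x) * X i (- y) = (gap y)%:~R * N%:R.
  under eq_bigr do rewrite mulr_suml.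
  rewrite exchange_big /= (bigD1 y) /=; last by rewrite ye.
  rewrite [X in _ + X]big1 => [|x /andP[/eqP xe ne_xy]].
    under eq_bigr do rewrite -mulrA -(charX _).2 subrr.
    by rewrite -mulr_sumr sum_trivial_two_part ?mul0rn // eqxx muln1 addr0.
  under eq_bigr do rewrite -mulrA -(charX _).2.
  rewrite -mulr_sumr sum_trivial_two_part; last by rewrite mulrnBl xe ye subrr.
  by rewrite subr_eq0 (negPf ne_xy) muln0 mulr0.
have intN : integralOver (intr : int -> K) (ratr ((gap y * N%:Z)%:~R / 2)).
  rewrite rmorphM fmorphV !rmorph_int rmorphM /= -invN mulr_suml.
  apply: integral_sum => i /forallP /= I_i.
  have [|z ->] := even_gap _ (charX i); first by move=> x; apply/eqP.
  rewrite mulrAC rmorph_nat mulfK ?pnatr_eq0 //.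
  apply: integral_mul; first exact: integral_id.
  apply: (integral_unity_root (card_finZmod_gt0 G)).
  exact: character_order.
have /intrP[w Ew] := integral_ratr intN.
have {Ew} Ew : (gap y * N%:Z = w * 2)%R.
  by apply: (@intr_inj rat); rewrite [RHS]intrM -Ew divfK.
have NE : N = (N./2 * 2 + 1)%N.
  by rewrite -[LHS]odd_double_half odd_card_kernel addnC muln2.
move: (gap_bounds y) Ew; rewrite NE; move: (gap y) N./2 w => g k w.
clear; nia.
Qed.

Variables (t mu : 'I_#|G| -> int).
Hypothesis eigenX : forall i, #|C|%:R - \sum_(c in C) X i c = (t i)%:~R.
Hypothesis signX : forall i, X i a = (-1) ^+ odd `|mu i|.
Hypothesis t_mu : forall i j, t i * mu j = t j * mu i.
Hypothesis t_eq0 : forall i, t i = 0 -> mu i = 0.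

(** This is the phase condition at time [pi / 2], in integers. *)
Lemma halved_eigenvalues i :
  exists u : int, t i = u * 2 /\ X i a = (-1) ^+ odd `|u|.
Proof.
have parity (x : int) : exists k : int, x = k * 2 + (odd `|x|)%:Z.
  by exists (x %/ 2)%Z; lia.
have odd_mu j : odd `|mu j| = (X j a == -1).
  by rewrite signX; case: odd; rewrite ?eqxx // expr0 eq_sym eqNr oner_eq0.
have [i0 Xi0] : exists i0, X i0 a = -1.
  have [/existsP[j /eqP]|/existsPn no] := boolP [exists j, X j a == -1].
    by exists j.
  case/eqP: a_neq0; apply: (character_family_separates sumX) => j.
  by rewrite signX odd_mu (negPf (no j)).
(* Composition with the projection makes the character trivial on the odd part and keeps its value
   at [a]. *)
pose beta := X i0 \o (fun x => x *+ e).
have charb : additive_character beta.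
  apply: character_comp => //; first by rewrite mul0rn.
  by move=> x y; rewrite mulrnDl.
have beta_e x : beta (x *+ e) = beta x by rewrite /beta /= ee.
have beta_a : beta a = -1 by rewrite /beta /= ea.
have idx chi (chiP : additive_character chi) : exists j, chi =1 X j.
  exact: (character_family_complete charX sumX).
have gap_t psi : additive_character psi -> (forall x, psi (x *+ e) = 1) ->
    exists j k, [/\ X j =1 (fun x => beta x * psi x),
      X k =1 (fun x => beta x ^+ 2 * psi x) &
      2 * \sum_(y | y *+ e == 0) (gap y)%:~R * psi y = (t j - t k)%:~R].
  move=> charp psi_e; rewrite -(eigenvalue_gap charb charp) //.
  have [j Ej] := idx _ (characterM charb charp).
  have [k Ek] := idx _ (characterM (characterM charb charb) charp).
  exists j, k; split; [by move=> x; rewrite -Ej|by move=> x; rewrite -Ek|].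
  rewrite rmorphB /= -!eigenX opprB addrACA addrC addrA subrK addrC.
  by congr (_ - _); apply: eq_bigr => c _; rewrite -?Ej -?Ek ?expr2.
have [b [b2 [Xb Xb2 gap1]]] := gap_t _ (trivial_character K G) (fun=> erefl).
have odd_b : odd `|mu b| by rewrite odd_mu Xb beta_a mulr1 eqxx.
have even_b2 : ~~ odd `|mu b2|.
  by rewrite odd_mu Xb2 beta_a sqrrN expr1n mulr1 eq_sym eqNr oner_eq0.
pose w := \sum_(y | y *+ e == 0) gap y.
have tw : t b - t b2 = w * 2.
  apply: (@intr_inj K); rewrite -gap1 intrM mulrC rmorph_sum.
  by congr (_ * _); apply: eq_bigr => y _; rewrite mulr1.
have [k1 mub] := parity (mu b); have [k2 mub2] := parity (mu b2).
rewrite odd_b in mub; rewrite (negPf even_b2) addr0 in mub2.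
(* If [w] were even, 4 would divide [t b], hence every [t j], and all gaps would vanish. Then
   [t b = t b2], and since [mu b - mu b2] is odd, proportionality gives [t b = 0], against the
   oddness of [mu b]. *)
have odd_w : odd `|w|.
  apply: contraT => even_w; have [v Ev] := parity w.
  rewrite (negPf even_w) addr0 in Ev.
  have t4b : (4 %| t b)%Z.
    apply: (@dvdz_exp2_odd 2 _ (mu b - mu b2)).
      by rewrite mub mub2; clear; lia.
    rewrite mulrBr (t_mu b b2) -mulrBl tw Ev; apply/dvdzP.
    by exists (mu b * v); ring.
  have t4 j : (4 %| t j)%Z.
    by apply: (@dvdz_exp2_odd 2 _ _ odd_b); rewrite t_mu dvdz_mulr.
  have gap0 y : y *+ e = 0 -> gap y = 0.
    apply: gap_eq0 => psi charp psi_e.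
    have [j [k [_ _ gap_psi]]] := gap_t psi charp psi_e.
    have [/dvdzP[x tj] /dvdzP[z tk]] := (t4 j, t4 k).
    exists (x - z); apply: (@mulfI _ 2); first by rewrite pnatr_eq0.
    by rewrite gap_psi tj tk; ring.
  have w0 : w = 0 by rewrite /w big1 // => y /eqP /gap0.
  have /eqP : t b * (mu b - mu b2) = 0.
    by rewrite mulrBr (t_mu b b2) -mulrBl tw w0 !mul0r.
  rewrite mulf_eq0 => /orP[/eqP tb0|]; last by rewrite mub mub2; clear; lia.
  by move: odd_b; rewrite (t_eq0 tb0).
have [v Ev] := parity w; rewrite odd_w in Ev.
have odd_o : odd `|mu b - mu b2| by rewrite mub mub2; clear; lia.
(* All factors except [t b] and 2 are odd, so [t b] is twice an odd [s]; proportionality carries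
   this to every [t i]. *)
have Eo : t b * (mu b - mu b2) = w * mu b * 2.
  by rewrite mulrBr (t_mu b b2) -mulrBl tw; ring.
have /dvdzP[s Es] : (2 %| t b)%Z.
  by apply: (@dvdz_exp2_odd 1 _ _ odd_o); rewrite Eo dvdz_mull.
have odd_s : odd `|s|.
  have /(congr1 (odd \o absz)) /= : s * (mu b - mu b2) = w * mu b.
    by apply: (@mulIf _ 2) => //; rewrite -Eo Es; ring.
  by rewrite !abszM !oddM odd_o odd_w odd_b andbT.
have Ei : t i * mu b = s * mu i * 2 by rewrite t_mu Es; ring.
have /dvdzP[u Eu] : (2 %| t i)%Z.
  by apply: (@dvdz_exp2_odd 1 _ _ odd_b); rewrite Ei dvdz_mull.
exists u; split=> //; rewrite signX; congr ((-1) ^+ nat_of_bool _).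
have /(congr1 (odd \o absz)) /= : u * mu b = s * mu i.
  by apply: (@mulIf _ 2) => //; rewrite -Ei Eu; ring.
by rewrite !abszM !oddM odd_s odd_b andbT.
Qed.

End Inversion.

End CyclicTwoPart.

(** * The involution and the projection onto the 2-part *)

Section SylowTwo.
Variable G : finZmodType.

Lemma finZmod_order2 (x : G) : x != 0 -> x *+ 2 = 0 -> #[x]%g = 2%N.
Proof. by move=> x0 x2; apply: nt_prime_order. Qed.

(** A cyclic group has at most one subgroup of each order, and [P], being normal, contains every
    involution. *)
Lemma cyclic_Sylow2_involution (P : {group G}) (a x : G) :
    (2.-Sylow([set: G]) P)%g -> cyclic P -> a != 0 -> a *+ 2 = 0 ->
  x *+ 2 = 0 -> x = 0 \/ x = a.
Proof.
move=> sylP cycP a0 a2 x2; have [->|x0] := eqVneq x 0; [by left|right].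
have nP : normal P [set: G].
  by rewrite -sub_abelian_normal ?subsetT // FinRing.Theory.zmod_abelian.
have inP (y : G) : y != 0 -> y *+ 2 = 0 -> <[y]>%g \subset P.
  move=> y0 y2; rewrite cycle_subG (mem_normal_Hall sylP nP) ?finset.in_setT //.
  by rewrite /p_elt finZmod_order2.
have : <[x]>%g == <[a]>%g :> {set G}.
  by rewrite (eq_subG_cyclic cycP) ?inP // -!orderE !finZmod_order2.
move/eqP/setP/(_ x); rewrite cycle_id !cycle2g ?finZmod_order2 // !inE.
by rewrite (negPf (x0 : x != 1%g)) => /esym/eqP.
Qed.

Lemma finZmod_mulrn_mod (x : G) k l : k = l %[mod #|G|] -> x *+ k = x *+ l.
Proof.
have red j : x *+ j = x *+ (j %% #|G|).
  by rewrite {1}(divn_eq j #|G|) mulrnDr mulnC mulrnA finZmod_mulrn mul0rn add0r.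
by move=> kl; rewrite red kl -red.
Qed.

(* [e] is 1 modulo the 2-part of [#|G|] and 0 modulo its odd part. *)
Lemma exists_two_part_projector (a : G) : a != 0 -> a *+ 2 = 0 ->
  exists e m : nat, [/\ forall x : G, x *+ e *+ (2 ^ m) = 0, a *+ e = a,
    forall x : G, x *+ e *+ e = x *+ e &
    forall k, coprime (k * e).*2.+1 #|G| ].
Proof.
move=> a0 a2; pose M := (#|G| `_2)%N; pose h := (#|G| `_(2^'))%N.
have nE : #|G| = (M * h)%N by rewrite partnC ?card_finZmod_gt0.
have co : coprime M h by apply: coprime_partC.
pose e := chinese M h 1 0.
have eM : e = 1 %[mod M] by apply: chinese_modl.
have /eqP eh : e == 0 %[mod h] by apply/eqP; apply: chinese_modr.
have h_e : (h %| e)%N by rewrite /dvdn eh mod0n.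
have ME : M = (2 ^ logn 2 #|G|)%N by rewrite /M p_part.
(* The involution [a] makes [M] even; hence [e] is odd and fixes [a]. *)
have M2 : (2 %| M)%N.
  rewrite ME dvdn_exp // logn_gt0 mem_primes card_finZmod_gt0 /=.
  by rewrite -(finZmod_order2 a0 a2) -cardsT order_dvdG ?finset.in_setT.
exists e, (logn 2 #|G|); split.
- move=> x; rewrite -ME -mulrnA; have /dvdnP[q ->] : (#|G| %| e * M)%N.
    by rewrite nE mulnC dvdn_mul.
  by rewrite mulnC mulrnA finZmod_mulrn mul0rn.
- have odd_e : odd e.
    have := congr1 (fun j => odd j) (divn_eq 1 2).
    have : e = 1 %[mod 2] by rewrite -(modn_dvdm e M2) eM modn_dvdm.
    by rewrite !modn2 => /eqP; case: odd.
  by rewrite -[e]odd_double_half odd_e mulrS -mul2n mulrnA a2 mul0rn addr0.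
- move=> x; rewrite -mulrnA; apply: finZmod_mulrn_mod; rewrite nE; apply/eqP.
  rewrite chinese_remainder // -modnMm eM modnMm muln1 eqxx /=.
  by rewrite -modnMm eh modnMm muln0.
move=> k; rewrite nE coprimeMr {1}ME coprimeXr ?coprimen2 //=; last first.
  by rewrite odd_double.
(* Modulo [h] the number is 1, since [h] divides [e]. *)
have /dvdnP[q ->] := h_e.
by rewrite mulnA doubleMl -addn1 /coprime gcdnC gcdnMDl gcdn1.
Qed.

End SylowTwo.

(** * The transition matrix *)

Section MatrixExponential.
Local Open Scope classical_set_scope.

(** The partial sums are combinations of the fixed matrices [B i], so only the scalar series in the
    coefficients have to converge. *)
Lemma expmx_spectral (K : numFieldType) n p (A : 'M[K]_n) (B : 'I_p -> 'M[K]_n)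
    (lam f : 'I_p -> K) :
    (forall k, A ^+ k = \sum_i lam i ^+ k *: B i) ->
    (forall i (eps : K), 0 < eps -> \forall N \near \oo,
       `|f i - \sum_(0 <= k < N) lam i ^+ k / k`!%:R| < eps) ->
  expmx A = \sum_i f i *: B i.
Proof.
move=> powA cvf; apply: cvg_lim; first exact: norm_hausdorff.
have -> : series (fun k => (k`!%:R)^-1 *: A ^+ k) =
    (fun N => \sum_i (\sum_(0 <= k < N) lam i ^+ k / k`!%:R) *: B i).
  apply/funext => N; rewrite /series /=.
  under [RHS]eq_bigr do rewrite scaler_suml.
  rewrite exchange_big; apply: eq_bigr => k _; rewrite powA scaler_sumr.
  by apply: eq_bigr => i _; rewrite scalerA mulrC.
apply: cvg_big => [|i _]; first exact: add_continuous.
by apply: cvgZr_tmp; apply/cvgrPdist_lt => eps; apply: cvf.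
Qed.

Variable R : realType.
Implicit Type x : R.

Definition cis x : R[i] := (cos x +i* sin x)%C.

Lemma cisD x y : cis (x + y) = cis x * cis y.
Proof.
apply/eqP; rewrite eq_complex /= cosD sinD addrC.
by apply/andP; split; apply/eqP; ring.
Qed.

Lemma norm_cis x : `|cis x| = 1.
Proof. by rewrite normc_def /= cos2Dsin2 sqrtr1. Qed.

Lemma cis_coeff x k :
  ('i * x%:C)%C ^+ k / k`!%:R = (cos_coeff x k +i* sin_coeff x k)%C :> R[i].
Proof.
have i_k : ('i : R[i])%C ^+ k = (-1) ^+ k./2 * (if odd k then 'i else 1)%C.
  rewrite -{1}[k]odd_double_half addnC exprD -mul2n exprM sqr_i.
  by case: odd.
have k_half : odd k -> k.-1./2 = k./2.
  by move=> odd_k; rewrite -[in LHS](odd_double_half k) odd_k /= doubleK.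
rewrite [RHS]complexE /= /cos_coeff /sin_coeff /= -exprnP.
rewrite !rmorphM /= !fmorphV /= !rmorphXn /= !rmorphN /= !rmorph1 !rmorph_nat.
rewrite exprMn i_k; case: ifP => [/k_half ->|_] /=; ring.
Qed.

Lemma cis_series x N :
  \sum_(0 <= k < N) ('i * x%:C)%C ^+ k / k`!%:R =
  (series (cos_coeff x) N +i* series (sin_coeff x) N)%C :> R[i].
Proof.
elim: N => [|N IHN]; first by rewrite /series /= !big_geq.
by rewrite /series /= !big_nat_recr //= IHN cis_coeff.
Qed.

Lemma cvg_cis_series x (eps : R[i]) : 0 < eps -> \forall N \near \oo,
  `|cis x - \sum_(0 <= k < N) ('i * x%:C)%C ^+ k / k`!%:R| < eps.
Proof.
(* Positivity in [R[i]] forces [eps] to be real. *)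
case: eps => e ie; rewrite ltcE /= => /andP[/eqP -> e0].
have e20 : 0 < e / 2 by rewrite divr_gt0.
have cvc : series (cos_coeff x) @ \oo --> cos x.
  by rewrite cos.unlock; apply: is_cvg_series_cos_coeff.
have cvs : series (sin_coeff x) @ \oo --> sin x.
  by rewrite sin.unlock; apply: is_cvg_series_sin_coeff.
have le_dist N : `|cis x - \sum_(0 <= k < N) ('i * x%:C)%C ^+ k / k`!%:R| <=
    (`|cos x - series (cos_coeff x) N| + `|sin x - series (sin_coeff x) N|)%:C%C.
  rewrite cis_series.
  set c := series (cos_coeff x) N; set s := series (sin_coeff x) N.
  have -> : cis x - (c +i* s)%C = ((cos x - c)%:C + 'i * (sin x - s)%:C)%C.
    by rewrite [LHS]complexE.
  rewrite (le_trans (ler_normD _ _)) // [X in _ <= X]rmorphD /= lerD //.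
    by rewrite normc_def /= expr0n addr0 sqrtr_sqr.
  rewrite normrM [X in X * _]normc_def /= expr0n add0r expr1n sqrtr1 mul1r.
  by rewrite normc_def /= expr0n addr0 sqrtr_sqr.
near=> N; rewrite (le_lt_trans (le_dist N)) // ltcR [e]splitr ltrD //.
  by near: N; move/cvgrPdist_lt: cvc; apply.
by near: N; move/cvgrPdist_lt: cvs; apply.
Unshelve. all: by end_near.
Qed.
End MatrixExponential.

(** * Spectral decomposition of a Cayley graph *)

Section CayleySpectrum.
Variables (G : finZmodType) (C : {set G}).
Hypothesis invC : forall c : G, c \in C -> - c \in C.

Lemma sum_connection_opp (V : nmodType) (F : G -> V) :
  \sum_(c in C) F (- c) = \sum_(c in C) F c.
Proof.
rewrite [RHS](reindex_inj oppr_inj); apply: eq_bigl => c.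
by apply/idP/idP => [/invC //|/invC]; rewrite opprK.
Qed.

Lemma cayley_eigenvalue_real (K : numClosedFieldType) (chi : G -> K) :
  additive_character chi -> \sum_(c in C) chi c \is Num.real.
Proof.
move=> chiP; rewrite CrealE rmorph_sum -[X in _ == X]sum_connection_opp.
by apply/eqP/eq_bigr => c _; rewrite characterN.
Qed.

Section Powers.
Variables (K : numClosedFieldType) (X : 'I_#|G| -> G -> K).
Hypothesis charX : forall i, additive_character (X i).
Hypothesis sumX : forall g, \sum_i X i g = (#|G| * (g == 0))%:R.

(** For a character [X i] this has rank one: its entries are [(X i u)^* * X i v / #|G|]. *)
Definition eigenprojection i : 'M[K]_#|G| :=
  #|G|%:R^-1 *: \matrix_(u, v) X i (enum_val v - enum_val u).

Lemma cayley_adjmx_exp (z : K) k :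
  (z *: adjmx K (cayley C)) ^+ k =
  \sum_i (z * \sum_(c in C) X i c) ^+ k *: eigenprojection i.
Proof.
elim: k => [|k IHk]; apply/matrixP => u v; rewrite summxE.
  rewrite expr0 mxE; under eq_bigr do rewrite expr0 !mxE mul1r.
  rewrite -mulr_sumr sumX subr_eq0 (inj_eq enum_val_inj) eq_sym natrM mulKf //.
  exact: card_neq0.
rewrite exprS IHk mxE; under [RHS]eq_bigr do rewrite exprSr !mxE.
under [LHS]eq_bigr do rewrite summxE mulr_sumr; rewrite exchange_big /=.
apply: eq_bigr => i _; rewrite -mulrA; under eq_bigr do rewrite !mxE.
rewrite mulrCA mulrA.
(* As a function on [G], the summand can be reindexed by [c = x - u]; this produces [X i (- c)], and
   [C = - C] restores the eigenvalue. *)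
pose F x := z * (x - enum_val u \in C)%:R *
  ((z * \sum_(c in C) X i c) ^+ k * (#|G|%:R^-1 * X i (enum_val v - x))).
rewrite -(big_enum_val F) /= /F (reindex_inj (addIr (enum_val u))) /=.
move: (_ ^+ k) => L {F}.
rewrite -sum_connection_opp mulr_sumr !mulr_suml [RHS]big_mkcond.
apply: eq_big => [x|x _]; first by rewrite inE.
rewrite addrK; case: ifP => _; last by rewrite mulr0 mul0r.
rewrite [x + _]addrC opprD addrA addrC [in LHS](charX i).2.
by rewrite /=; ring.
Qed.
End Powers.

Section Transition.
Variables (R : realType) (X : 'I_#|G| -> G -> R[i]).
Hypothesis charX : forall i, additive_character (X i).
Hypothesis sumX : forall g, \sum_i X i g = (#|G| * (g == 0))%:R.

Definition cayley_eigenvalue i : R := complex.Re (\sum_(c in C) X i c).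

Lemma cayley_eigenvalueE i :
  \sum_(c in C) X i c = (cayley_eigenvalue i)%:C%C.
Proof. by rewrite RRe_real //; apply: cayley_eigenvalue_real. Qed.

Lemma transition_cayley t u v :
  transition (cayley C) t (enum_rank u) (enum_rank v) =
  #|G|%:R^-1 * \sum_i cis (t * cayley_eigenvalue i) * X i (v - u).
Proof.
rewrite /transition.
rewrite (@expmx_spectral _ _ _ _ (eigenprojection X)
  (fun i => ('i * t%:C)%C * \sum_(c in C) X i c)
  (fun i => cis (t * cayley_eigenvalue i))).
- rewrite summxE mulr_sumr; apply: eq_bigr => i _.
  by rewrite !mxE !enum_rankK mulrCA.
- by move=> k; apply: cayley_adjmx_exp.
move=> i eps eps_gt0; rewrite cayley_eigenvalueE -mulrA -rmorphM.
exact: cvg_cis_series.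
Qed.

(** This is the equality case of the triangle inequality: an average of unimodular numbers is
    unimodular only if they all coincide. *)
Lemma transition_cayley_norm1 t u v :
  `|transition (cayley C) t (enum_rank u) (enum_rank v)| = 1 <->
  exists gamma : R[i], `|gamma| = 1 /\
    forall i, cis (t * cayley_eigenvalue i) * X i (v - u) = gamma.
Proof.
have n_neq0 := card_neq0 R[i] G.
rewrite transition_cayley normrM normfV normr_nat.
have norm1 i : `|cis (t * cayley_eigenvalue i) * X i (v - u)| = 1.
  by rewrite normrM norm_cis character_norm ?mulr1.
split=> [/(canRL (mulVKf n_neq0)) eq_n|[gamma [gamma1 Egamma]]].
  have [|gamma /eqP gamma1 Egamma] := normC_sum_eq (P := predT)
      (F := fun i => cis (t * cayley_eigenvalue i) * X i (v - u)).
    by rewrite eq_n mulr1 (eq_bigr _ (fun i _ => norm1 i)) sumr_const card_ord.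
  by exists gamma; split=> // i; rewrite Egamma // norm1 mul1r.
rewrite (eq_bigr _ (fun i _ => Egamma i)) sumr_const card_ord normrMn gamma1.
by rewrite mulVf.
Qed.
End Transition.
End CayleySpectrum.

Section Circle.
Variable R : realType.

Lemma cis0 : cis (0 : R) = 1. Proof. by rewrite /cis cos0 sin0. Qed.

Lemma cis_neq0 (x : R) : cis x != 0.
Proof. by rewrite -normr_eq0 norm_cis oner_eq0. Qed.

Lemma cis_pi_int (m : int) : cis (pi * m%:~R : R) = (-1) ^+ odd `|m|.
Proof.
have cispi : cis (pi : R) = -1.
  by apply/eqP; rewrite eq_complex /= cospi sinpi oppr0 !eqxx.
have pos (k : nat) : cis (pi * k%:R : R) = (-1) ^+ odd k.
  rewrite signr_odd; elim: k => [|k IHk]; first by rewrite mulr0 cis0.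
  by rewrite mulrSr mulrDr mulr1 cisD IHk cispi exprSr.
case: m => k; first exact: pos.
rewrite NegzE rmorphN mulrN abszN; apply: (mulIf (cis_neq0 (pi * k.+1%:R))).
by rewrite -cisD addNr cis0 pos -signr_addb addbb.
Qed.

(** Removing [Num.floor (x / pi)] multiples of [pi] leaves a remainder in [[0, pi)], and [sin] is
    positive inside. *)
Lemma sin_eq0_pi (x : R) : sin x = 0 -> exists m : int, x = pi * m%:~R.
Proof.
move=> sinx; have pi0 := pi_gt0 R; pose m := Num.floor (x / pi).
exists m; apply/eqP; rewrite -subr_eq0; apply: contraT => y_neq0.
have y_itv : 0 < x - pi * m%:~R < pi.
  have /andP[le_mx lt_xm] := floor_itv (x / pi).
  rewrite lt0r y_neq0 subr_ge0 mulrC -ler_pdivlMr // le_mx /=.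
  by rewrite ltrBlDr addrC -[X in _ + X]mul1r -mulrDl -ltr_pdivrMr // -(intrD _ m 1).
have : cis x = cis (x - pi * m%:~R) * (-1) ^+ odd `|m|.
  by rewrite -cis_pi_int -cisD subrK.
move/(congr1 (@complex.Im R)) => /=; rewrite sinx => /esym/eqP.
have := sin_gt0_pi y_itv; case: odd.
  by rewrite mulrN1 /= oppr_eq0 => /gt_eqF ->.
by rewrite mulr1 /= => /gt_eqF ->.
Qed.
End Circle.

(** * Consequences of state transfer for the eigenvalues *)

Section CayleyTransfer.
Variables (R : realType) (G : finZmodType) (C : {set G}).
Hypothesis invC : forall c : G, c \in C -> - c \in C.
Variable X : 'I_#|G| -> G -> R[i].
Hypothesis charX : forall i, additive_character (X i).
Hypothesis sumX : forall g, \sum_i X i g = (#|G| * (g == 0))%:R.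
Local Notation theta i := (#|C|%:R - cayley_eigenvalue C X i).

(** The trivial character, with eigenvalue [#|C|], determines the common phase. *)
Lemma pst_phase tau u v :
    `|transition (cayley C) tau (enum_rank u) (enum_rank v)| = 1 ->
  forall i, X i (v - u) = cis (tau * theta i).
Proof.
move/(transition_cayley_norm1 invC charX sumX) => [gamma [_ Egamma]] i.
have [i1 Xi1] := character_family_complete charX sumX (trivial_character R[i] G).
have Ei1 : cayley_eigenvalue C X i1 = #|C|%:R.
  apply: complexI; rewrite -cayley_eigenvalueE // -(eq_bigr _ (fun c _ => Xi1 c)).
  by rewrite sumr_const rmorph_nat.
have := Egamma i; rewrite -(Egamma i1) -Xi1 mulr1 Ei1 => E.
apply: (mulfI (cis_neq0 (tau * cayley_eigenvalue C X i))).
by rewrite E -cisD -mulrDr addrC subrK.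
Qed.

(** A character and its inverse have the same eigenvalue because [C = - C], hence the same phase, so
    they agree at [a]. *)
Lemma pst_involution (tau : R) a :
    (forall i, X i a = cis (tau * theta i)) -> a *+ 2 = 0.
Proof.
move=> phase; apply: (character_family_separates sumX) => i.
have charN : additive_character (X i \o (fun x => - x)).
  by apply: character_comp => //; [rewrite oppr0|exact: opprD].
have [j Xj] := character_family_complete charX sumX charN.
have Eij : cayley_eigenvalue C X j = cayley_eigenvalue C X i.
  apply: complexI; rewrite -!cayley_eigenvalueE // -[RHS](sum_connection_opp invC).
  by apply: eq_bigr => c _; rewrite -Xj.
have XaN : X i (- a) = X i a by rewrite phase -Eij -phase -Xj.
by rewrite mulr2n (charX i).2 -{2}XaN -(charX i).2 subrr (charX i).1.
Qed.

Lemma pst_integral_eigenvalues (tau : R) a : a != 0 ->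
    (forall i, X i a = cis (tau * theta i)) ->
  exists t mu : 'I_#|G| -> int,
    [/\ forall i, theta i = (t i)%:~R, forall i, X i a = (-1) ^+ odd `|mu i|,
        forall i j, t i * mu j = t j * mu i & forall i, t i = 0 -> mu i = 0].
Proof.
move=> a_neq0 phase; have a2 := pst_involution phase.
have pi0 : pi != 0 :> R by rewrite gt_eqF ?pi_gt0.
(* Since [a *+ 2 = 0], the phase [X i a] is 1 or -1 and its sine vanishes. *)
have /fin_all_exists[mu Emu] : forall i, exists k : int, tau * theta i = pi * k%:~R.
  move=> i; apply: sin_eq0_pi.
  have : X i a ^+ 2 == 1 by rewrite -character_mulrn // a2 (charX i).1.
  rewrite phase sqrf_eq1 => /orP[] /eqP/(congr1 (@complex.Im R)) //=.
  by rewrite oppr0.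
have signX i : X i a = (-1) ^+ odd `|mu i| by rewrite phase Emu cis_pi_int.
have [i0 mu_i0] : exists i, mu i != 0.
  have [/existsP//|/existsPn mu0] := boolP [exists i, mu i != 0].
  case/eqP: a_neq0; apply: (character_family_separates sumX) => i.
  by rewrite signX (eqP (negbNE (mu0 i))).
have tau0 : tau != 0.
  apply: contraNneq mu_i0 => tau0; have /esym/eqP := Emu i0.
  by rewrite tau0 mul0r mulf_eq0 (negPf pi0) intr_eq0.
have theta_mu i j : theta i * (mu j)%:~R = theta j * (mu i)%:~R.
  apply: (mulfI tau0); rewrite !mulrA !Emu; ring.
have theta_eq0 i : theta i = 0 -> mu i = 0.
  move=> t0; have /esym/eqP := Emu i.
  by rewrite t0 mulr0 mulf_eq0 (negPf pi0) intr_eq0 => /eqP.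
(* The eigenvalues sum to the trace, which counts the loops. *)
have sum_theta : \sum_i theta i = (#|G| * #|C|)%:R - (#|G| * (0 \in C))%:R.
  apply: complexI; rewrite rmorph_sum rmorphB !rmorph_nat /=.
  under eq_bigr do rewrite rmorphB rmorph_nat /= -cayley_eigenvalueE //.
  rewrite sumrB sumr_const card_ord natrM mulr_natl; congr (_ - _).
  rewrite exchange_big /=; under eq_bigr do rewrite sumX.
  rewrite -natr_sum -big_distrr /=; congr ((_ * _)%:R).
  rewrite big_mkcond (bigD1 0) //= eqxx big1 ?addn0; first by case: (0 \in C).
  by move=> c /negPf->; case: ifP.
(* Otherwise the [theta i] sum to 0, so [C] has no element besides 0; then every [theta i], and so
   every [mu i], is 0. *)
have sum_mu : \sum_i mu i != 0.
  apply: contraNneq mu_i0 => mu0.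
  have : \sum_i theta i = 0.
    apply: (mulfI tau0); rewrite mulr0 mulr_sumr.
    by rewrite (eq_bigr _ (fun i _ => Emu i)) -mulr_sumr -rmorph_sum mu0 mulr0.
  rewrite sum_theta => /eqP; rewrite subr_eq0 eqr_nat eqn_pmul2l ?card_finZmod_gt0 //.
  rewrite (cardsD1 0) -[X in _ == X]addn0 eqn_add2l cards_eq0 => /eqP C0.
  apply/eqP/theta_eq0/complexI; rewrite rmorphB rmorph_nat /= -cayley_eigenvalueE //.
  rewrite (eq_bigr (fun=> 1)) ?sumr_const ?subrr // => c Cc.
  have /setP/(_ c) := C0; rewrite !inE Cc andbT => /negbFE/eqP->.
  exact: (charX _).1.
have /fin_all_exists[t Et] : forall i, exists k : int, theta i = k%:~R.
  move=> i; pose N : int := (#|G| * #|C|)%:Z - (#|G| * (0 \in C))%:Z.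
  (* Summing [theta_mu i j] over [j] gives [theta i] times the sum of all [mu j] as [mu i * N]. *)
  pose q : rat := (mu i * N)%:~R / (\sum_j mu j)%:~R.
  have Eq : theta i = ratr q.
    rewrite /q rmorphM fmorphV !rmorph_int; apply: (canRL (mulfK _)).
      by rewrite intr_eq0.
    rewrite rmorph_sum /= mulr_sumr (eq_bigr _ (fun j _ => theta_mu i j)).
    by rewrite -mulr_suml sum_theta intrM mulrC rmorphB.
  have : integralOver (intr : int -> R[i]) (ratr q).
    have -> : ratr q = (theta i)%:C%C :> R[i] by rewrite Eq fmorph_rat.
    rewrite rmorphB rmorph_nat /= -cayley_eigenvalueE //; apply: integral_sub.
      exact: integral_nat.
    apply: integral_sum => c _; apply: (integral_unity_root (card_finZmod_gt0 G)).
    exact: character_order.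
  by move/integral_ratr/intrP=> [k Ek]; exists k; rewrite Eq Ek ratr_int.
exists t, mu; split=> // [i j|i t0]; last by apply: theta_eq0; rewrite Et t0.
by apply: (@intr_inj R); rewrite !intrM -!Et.
Qed.

End CayleyTransfer.

Theorem theorem7p2 (R : realType) (G : finZmodType)
    (P : {group G}) (sylP : (2.-Sylow([set: G]) P)%g) (cycP : cyclic P)
    (C : {set G}) (invC : forall c : G, c \in C -> - c \in C) :
  pst R (cayley C) -> pst_at (cayley C) (pi / 2 : R).
Proof.
have [X [charX sumX]] := exists_character_family R[i] G.
move=> [tau [u [v [neq_uv /(pst_phase invC charX sumX)]]]].
set a := v - u => phase.
have a_neq0 : a != 0 by rewrite subr_eq0 eq_sym; apply/eqP.
have a2 := pst_involution invC charX sumX phase.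
have [t [mu [Et signX t_mu t_eq0]]] :=
  pst_integral_eigenvalues invC charX sumX a_neq0 phase.
have eigenX i : #|C|%:R - \sum_(c in C) X i c = (t i)%:~R.
  rewrite cayley_eigenvalueE // -(rmorph_nat (real_complex R)) -rmorphB Et.
  exact: rmorph_int.
have intC (chi : G -> R[i]) : additive_character chi ->
    exists l : int, \sum_(c in C) chi c = l%:~R.
  move=> /(character_family_complete charX sumX)[i Xi].
  exists (#|C|%:Z - t i); rewrite (eq_bigr _ (fun c _ => Xi c)).
  by rewrite rmorphB /= -eigenX subKr.
have [e [m [e2m ea ee co_e]]] := exists_two_part_projector a_neq0 a2.
have half := halved_eigenvalues intC a_neq0 a2
  (fun x => cyclic_Sylow2_involution sylP cycP a_neq0 a2) e2m ea ee co_e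
  charX sumX eigenX signX t_mu t_eq0.
exists u, v; split=> //; apply/(transition_cayley_norm1 invC charX sumX).
(* The witness is the value at the trivial character. For [X i] the eigenvalue is [#|C| - 2 * k],
   and the factor [(-1) ^+ odd k] supplied by [half] makes up the difference. *)
exists (cis (pi / 2 * #|C|%:R)); split=> [|i]; first exact: norm_cis.
have [k [tk ->]] := half i.
rewrite -cis_pi_int -cisD -[cayley_eigenvalue C X i](subKr #|C|%:R) Et tk.
by congr cis; rewrite intrM; field.
Qed.
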